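(* Suppose $K_m=1$ for every $m\in\mathcal M$. Then the latency-reduction objective $F$, regarded as a set function $F:2^V\to\mathbb R$ on the ground set $V=V_1\cup\dots\cup V_N$, is monotone non-decreasing and submodular. Consequently problem $\mathcal P1$ is the maximization of a monotone non-decreasing submodular set function subject to $N$ knapsack constraints (one for each edge server $n$: $\sum_{m}\sum_{\ell}\sum_{i\in\mathcal E_m^{(\ell)}}x_{n,i}b_m\le Q_n$).
   Context: Setting. Finite nonempty sets: edge servers $\mathcal N=\{1,\dots,N\}$, users $\mathcal U$ with $|\mathcal U|=U$, models $\mathcal M$. Model $m$ has layers $\mathcal L_m$; layer $\ell$ has a finite set $\mathcal E_m^{(\ell)}$ of $E_m$ experts (all these sets are pairwise disjoint), each expert of model $m$ having size $b_m>0$. An integer $1\le K_m\le E_m$ is given and $\mathcal A_m^{(\ell)}=\{S\subseteq\mathcal E_m^{(\ell)}:|S|=K_m\}$. Server $n$ has storage capacity $Q_n\geq 0$. Each user $u$ has an associated server $n_u\in\mathcal N$ and fixed indicators $\rho_{u,i}\in\{0,1\}$ (expert $i$ is stored locally at $u$). Given probabilities: $p_{u,m}\ge0$ (user $u$ requests model $m$) and $p_{u,S}\ge 0$ for $S\in\mathcal A_m^{(\ell)}$ (user $u$ activates $S$ in layer $\ell$ of $m$). Latency constants (positive reals, independent of the caching decision): with $D_m>0$ the hidden-state size and positive link rates $R$, $T^{\rm UL}_{u,n_u,m}=D_m/R^{\rm UL}_{u,n_u}$, $T^{\rm DL}_{u,n_u,m}=D_m/R^{\rm DL}_{u,n_u}$,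 $T_{n,n',m}=D_m/R_{n,n'}$ ($n\ne n'$), $T_{n,{\rm C},m}=D_m/R_{n,{\rm C}}$, $T_{{\rm C},n,m}=D_m/R_{{\rm C},n}$ (C is the cloud, which stores all experts); computing latencies $T^{\rm CP}_{u,m}$ (user), $T^{\rm CP}_{{\rm E},m}$ (edge), $T^{\rm CP}_{{\rm C},m}$ (cloud). Caching decision: binary $\mathbf X=(x_{n,i})$, where $x_{n,i}=1$ iff server $n$ caches expert $i$. Let $E=\sum_m|\mathcal L_m|E_m$ and $V=\bigcup_{n}V_n$, $V_n=\{v_i^n: i \text{ an expert}\}$, $|V_n|=E$; $\mathbf X$ is identified with the subset $\{v_i^n:x_{n,i}=1\}\subseteq V$. Routing for user $u$ and $S\in\mathcal A_m^{(\ell)}$: each $i\in S$ is served locally if $\rho_{u,i}=1$; otherwise at $n_u$ if $x_{n_u,i}=1$; otherwise at exactly one server $n'\ne n_u$ with $x_{n',i}=1$ if such a server exists; otherwise at the cloud. Let $\beta_{u,n_u,S},\beta_{u,n',S},\beta_{u,{\rm C},S}$ be the numbers of experts of $S$ served at $n_u$, at $n'\neq n_u$, and at the cloud; the assignment to servers $n'\ne n_u$ is chosen to minimize the latency. Put $$T^{\rm OE}=\sum_{n'\ne n_u}\big[\mathbb I(\beta_{u,n',S}>0)(T_{n_u,n',m}+T^{\rm CP}_{{\rm E},m})+\beta_{u,n',S}T_{n',n_u,m}\big],$$ $$T^{\rm out}_{u,S}=T^{\rm UL}_{u,n_u,m}+\Big(K_m-\sum_{i\in S}\rho_{u,i}\Big)T^{\rm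 DL}_{u,n_u,m}+\mathbb I(\beta_{u,n_u,S}>0)T^{\rm CP}_{{\rm E},m}+T^{\rm OE}+\mathbb I(\beta_{u,{\rm C},S}>0)(T_{n_u,{\rm C},m}+T^{\rm CP}_{{\rm C},m})+\beta_{u,{\rm C},S}T_{{\rm C},n_u,m},$$ $$T^{\rm token}_{u,S}(\mathbf X)=\prod_{i\in S}\rho_{u,i}\,T^{\rm CP}_{u,m}+\Big(1-\prod_{i\in S}\rho_{u,i}\Big)T^{\rm out}_{u,S}.$$ Let $T^{\max}_{u,S}=T^{\rm token}_{u,S}(\emptyset)$ (no expert cached at any edge server) and $r_{u,S}(\mathbf X)=T^{\max}_{u,S}-T^{\rm token}_{u,S}(\mathbf X)$. The objective is $$F(\mathbf X)=\frac1U\sum_{u\in\mathcal U}\sum_{m\in\mathcal M}p_{u,m}\sum_{\ell\in\mathcal L_m}\sum_{S\in\mathcal A_m^{(\ell)}}p_{u,S}\,r_{u,S}(\mathbf X).$$ Problem $\mathcal P1$: maximize $F(\mathbf X)$ over binary $\mathbf X$ subject to $\sum_{m}\sum_{\ell}\sum_{i\in\mathcal E_m^{(\ell)}}x_{n,i}b_m\le Q_n$ for all $n\in\mathcal N$. Standing assumption (cloud access is slower than edge access): for all $m$ and all $n\ne n'$, $T_{n,n',m}+T_{n',n,m}+T^{\rm CP}_{{\rm E},m}\le T_{n,{\rm C},m}+T_{{\rm C},n,m}+T^{\rm CP}_{{\rm C},m}$, and for all $n$, $T^{\rm CP}_{{\rm E},m}\le T_{n,{\rm C},m}+T_{{\rm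 C},n,m}+T^{\rm CP}_{{\rm C},m}$. A set function $f:2^V\to\mathbb R$ is submodular if $f(X)+f(Y)\ge f(X\cup Y)+f(X\cap Y)$ for all $X,Y\subseteq V$, and monotone non-decreasing if $f(X)\le f(Y)$ whenever $X\subseteq Y$. *)

(* Defs.v *)
From HB Require Import structures.
From mathcomp Require Import all_boot all_order all_algebra.
Set Implicit Arguments.
Unset Strict Implicit.
Unset Printing Implicit Defensive.
Import Order.TTheory GRing.Theory Num.Theory.
Local Open Scope ring_scope.

Definition monotone_nondecreasing (R : realFieldType) (V : finType)
    (f : {set V} -> R) : Prop :=
  forall X Y : {set V}, X \subset Y -> f X <= f Y.

Definition submodular (R : realFieldType) (V : finType)
    (f : {set V} -> R) : Prop :=
  forall X Y : {set V}, f X + f Y >= f (X :|: Y) + f (X :&: Y).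

Record max_problem (R : realFieldType) := MaxProblem {
  domain : Type;
  objective : domain -> R;
  feasible : domain -> Prop }.

Definition optimal (R : realFieldType) (P : max_problem R) (x : domain P) :=
  feasible x /\ forall y : domain P, feasible y -> objective y <= objective x.

Definition knapsack_max (R : realFieldType) (V : finType) (k : nat)
    (f : {set V} -> R) (w : 'I_k -> V -> R) (c : 'I_k -> R) : max_problem R :=
  MaxProblem f (fun X => forall j : 'I_k, \sum_(v in X) w j v <= c j).

Definition same_problem (R : realFieldType) (P Q : max_problem R)
    (phi : domain P -> domain Q) : Prop :=
  [/\ bijective phi,
      forall x, objective x = objective (phi x)
    & forall x, feasible x <-> feasible (phi x)].

Lemma same_problem_optimal (R : realFieldType) (P Q : max_problem R)
    (phi : domain P -> domain Q) :
  same_problem phi -> forall x, optimal x <-> optimal (phi x).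
Proof.
move=> [[psi _ psiK] obj feas] x; split=> -[fx mx].
  split=> [|y fy]; first exact/feas.
  by rewrite -obj -(psiK y) -obj; apply/mx/feas; rewrite psiK.
by split=> [|y fy]; [exact/feas | rewrite !obj; apply/mx/feas].
Qed.

(* Layers of all models form one finite type, and so do the experts of all
   layers; the sets of layers of a model and of experts of a layer are the
   fibres of model_of and layer_of, hence are pairwise disjoint. *)
Record moe_system (R : realFieldType) := MoeSystem {
  n_server : nat;
  user : finType;
  model : finType;
  layer : finType;
  expert : finType;
  model_of : layer -> model;
  layer_of : expert -> layer;
  n_expert : model -> nat;                      (* E_m *)
  n_active : model -> nat;                      (* K_m *)
  expert_size : model -> R;                     (* b_m *)
  capacity : 'I_n_server -> R;                  (* Q_n *)
  home : user -> 'I_n_server;                   (* n_u *)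
  local : user -> expert -> bool;               (* rho_{u,i} *)
  p_model : user -> model -> R;                 (* p_{u,m} *)
  p_act : user -> {set expert} -> R;            (* p_{u,S} *)
  hidden_size : model -> R;                     (* D_m *)
  rate_UL : user -> 'I_n_server -> R;           (* R^UL_{u,n} *)
  rate_DL : user -> 'I_n_server -> R;           (* R^DL_{u,n} *)
  rate_EE : 'I_n_server -> 'I_n_server -> R;    (* R_{n,n'} *)
  rate_EC : 'I_n_server -> R;                   (* R_{n,C} *)
  rate_CE : 'I_n_server -> R;                   (* R_{C,n} *)
  cp_user : user -> model -> R;                 (* T^CP_{u,m} *)
  cp_edge : model -> R;                         (* T^CP_{E,m} *)
  cp_cloud : model -> R;                        (* T^CP_{C,m} *)
  n_server_gt0 : (0 < n_server)%N;
  user_gt0 : (0 < #|user|)%N;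
  model_gt0 : (0 < #|model|)%N;
  card_layer : forall l : layer,
    #|[set i : expert | layer_of i == l]| = n_expert (model_of l);
  n_active_bounds : forall m, (1 <= n_active m <= n_expert m)%N;
  expert_size_gt0 : forall m, 0 < expert_size m;
  capacity_ge0 : forall n, 0 <= capacity n;
  p_model_ge0 : forall u m, 0 <= p_model u m;
  p_act_ge0 : forall u (l : layer) (S : {set expert}),
    S \subset [set i | layer_of i == l] -> #|S| = n_active (model_of l) ->
    0 <= p_act u S;
  hidden_size_gt0 : forall m, 0 < hidden_size m;
  rate_UL_gt0 : forall u, 0 < rate_UL u (home u);
  rate_DL_gt0 : forall u, 0 < rate_DL u (home u);
  rate_EE_gt0 : forall n n', n != n' -> 0 < rate_EE n n';
  rate_EC_gt0 : forall n, 0 < rate_EC n;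
  rate_CE_gt0 : forall n, 0 < rate_CE n;
  cp_user_gt0 : forall u m, 0 < cp_user u m;
  cp_edge_gt0 : forall m, 0 < cp_edge m;
  cp_cloud_gt0 : forall m, 0 < cp_cloud m }.

Definition server (R : realFieldType) (s : moe_system R) : finType :=
  'I_(n_server s).

(* The ground set V: the element v_i^n is the pair (n, i). *)
Definition ground (R : realFieldType) (s : moe_system R) : finType :=
  (server s * expert s)%type.

Definition ground_server (R : realFieldType) (s : moe_system R)
  (n : server s) : {set ground s} := [set v | v.1 == n].

Definition layers (R : realFieldType) (s : moe_system R) (m : model s) :
  {set layer s} := [set l | model_of l == m].

Definition experts (R : realFieldType) (s : moe_system R) (l : layer s) :
  {set expert s} := [set i | layer_of i == l].

Definition activations (R : realFieldType) (s : moe_system R) (l : layer s) :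
  {set {set expert s}} :=
  [set S : {set expert s} |
     (S \subset experts l) && (#|S| == n_active (model_of l))].

Definition T_UL (R : realFieldType) (s : moe_system R)
  (u : user s) (m : model s) : R := hidden_size m / rate_UL u (home u).
Definition T_DL (R : realFieldType) (s : moe_system R)
  (u : user s) (m : model s) : R := hidden_size m / rate_DL u (home u).
Definition T_EE (R : realFieldType) (s : moe_system R)
  (n n' : server s) (m : model s) : R := hidden_size m / rate_EE n n'.
Definition T_EC (R : realFieldType) (s : moe_system R)
  (n : server s) (m : model s) : R := hidden_size m / rate_EC n.
Definition T_CE (R : realFieldType) (s : moe_system R)
  (n : server s) (m : model s) : R := hidden_size m / rate_CE n.

Definition cloud_slower (R : realFieldType) (s : moe_system R) : Prop :=
  (forall (m : model s) (n n' : server s), n != n' ->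
     T_EE n n' m + T_EE n' n m + cp_edge m
       <= T_EC n m + T_CE n m + cp_cloud m) /\
  (forall (m : model s) (n : server s),
     cp_edge m <= T_EC n m + T_CE n m + cp_cloud m).

Definition decision (R : realFieldType) (s : moe_system R) : finType :=
  {ffun server s * expert s -> bool}.

Definition set_of_decision (R : realFieldType) (s : moe_system R)
  (x : decision s) : {set ground s} := [set v | x v].

Definition decision_of_set (R : realFieldType) (s : moe_system R)
  (X : {set ground s}) : decision s := [ffun v => v \in X].

Lemma set_of_decisionK (R : realFieldType) (s : moe_system R) :
  cancel (@set_of_decision R s) (@decision_of_set R s).
Proof. by move=> x; apply/ffunP=> v; rewrite ffunE inE. Qed.

Lemma decision_of_setK (R : realFieldType) (s : moe_system R) :
  cancel (@decision_of_set R s) (@set_of_decision R s).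
Proof. by move=> X; apply/setP=> v; rewrite inE ffunE. Qed.

Definition served_home (R : realFieldType) (s : moe_system R) (x : decision s)
  (u : user s) (i : expert s) : bool := ~~ local u i && x (home u, i).

Definition served_other (R : realFieldType) (s : moe_system R) (x : decision s)
    (u : user s) (i : expert s) : bool :=
  [&& ~~ local u i, ~~ x (home u, i)
    & [exists n' : server s, (n' != home u) && x (n', i)]].

Definition served_cloud (R : realFieldType) (s : moe_system R) (x : decision s)
    (u : user s) (i : expert s) : bool :=
  [&& ~~ local u i, ~~ x (home u, i)
    & ~~ [exists n' : server s, (n' != home u) && x (n', i)]].

(* An assignment gives the server n' <> n_u that serves each expert of S which
   has to be served by such a server; its other values are irrelevant. *)
Definition assignment (R : realFieldType) (s : moe_system R) : finType :=
  {ffun expert s -> server s}.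

Definition admissible (R : realFieldType) (s : moe_system R) (x : decision s)
    (u : user s) (S : {set expert s}) (a : assignment s) : bool :=
  [forall i in S,
     served_other x u i ==> ((a i != home u) && x (a i, i))].

Definition beta_home (R : realFieldType) (s : moe_system R) (x : decision s)
  (u : user s) (S : {set expert s}) : nat := #|[set i in S | served_home x u i]|.

Definition beta_other (R : realFieldType) (s : moe_system R) (x : decision s)
    (u : user s) (S : {set expert s}) (a : assignment s) (n' : server s) : nat :=
  #|[set i in S | served_other x u i && (a i == n')]|.

Definition beta_cloud (R : realFieldType) (s : moe_system R) (x : decision s)
  (u : user s) (S : {set expert s}) : nat :=
  #|[set i in S | served_cloud x u i]|.

Definition T_OE (R : realFieldType) (s : moe_system R) (x : decision s)
    (u : user s) (m : model s) (S : {set expert s}) (a : assignment s) : R :=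
  \sum_(n' : server s | n' != home u)
    ((0 < beta_other x u S a n')%N%:R * (T_EE (home u) n' m + cp_edge m)
     + (beta_other x u S a n')%:R * T_EE n' (home u) m).

Definition T_out_of (R : realFieldType) (s : moe_system R) (x : decision s)
    (u : user s) (m : model s) (S : {set expert s}) (a : assignment s) : R :=
  T_UL u m
  + ((n_active m)%:R - \sum_(i in S) (local u i)%:R) * T_DL u m
  + (0 < beta_home x u S)%N%:R * cp_edge m
  + T_OE x u m S a
  + (0 < beta_cloud x u S)%N%:R * (T_EC (home u) m + cp_cloud m)
  + (beta_cloud x u S)%:R * T_CE (home u) m.

(* Only a starting point for the arg min below, see default_admissible. *)
Definition default_assignment (R : realFieldType) (s : moe_system R)
    (x : decision s) (u : user s) : assignment s :=
  [ffun i => odflt (home u) [pick n' | (n' != home u) && x (n', i)]].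

Definition best_assignment (R : realFieldType) (s : moe_system R)
    (x : decision s) (u : user s) (m : model s) (S : {set expert s}) :
    assignment s :=
  [arg min_(a < default_assignment x u | admissible x u S a)
     T_out_of x u m S a]%O.

Lemma default_admissible (R : realFieldType) (s : moe_system R)
    (x : decision s) (u : user s) (S : {set expert s}) :
  admissible x u S (default_assignment x u).
Proof.
apply/'forall_implyP=> i _; apply/implyP=> /and3P[_ _ /existsP[n' hn']].
by rewrite ffunE; case: pickP => [//|/(_ n')]; rewrite hn'.
Qed.

Lemma best_assignmentP (R : realFieldType) (s : moe_system R)
    (x : decision s) (u : user s) (m : model s) (S : {set expert s}) :
  admissible x u S (best_assignment x u m S) /\
  forall a, admissible x u S a ->
    T_out_of x u m S (best_assignment x u m S) <= T_out_of x u m S a.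
Proof.
rewrite /best_assignment; case: arg_minP => [|a adm min_a].
  exact: default_admissible.
by split.
Qed.

Definition T_out (R : realFieldType) (s : moe_system R) (x : decision s)
  (u : user s) (m : model s) (S : {set expert s}) : R :=
  T_out_of x u m S (best_assignment x u m S).

Definition T_token (R : realFieldType) (s : moe_system R) (x : decision s)
    (u : user s) (m : model s) (S : {set expert s}) : R :=
  (\prod_(i in S) (local u i)%:R) * cp_user u m
  + (1 - \prod_(i in S) (local u i)%:R) * T_out x u m S.

Definition T_max (R : realFieldType) (s : moe_system R)
  (u : user s) (m : model s) (S : {set expert s}) : R :=
  T_token (decision_of_set set0) u m S.

Definition reduction (R : realFieldType) (s : moe_system R) (x : decision s)
  (u : user s) (m : model s) (S : {set expert s}) : R :=
  T_max u m S - T_token x u m S.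

Definition latency_reduction (R : realFieldType) (s : moe_system R)
    (x : decision s) : R :=
  1 / #|user s|%:R *
  \sum_(u : user s) \sum_(m : model s) p_model u m *
    \sum_(l in layers m) \sum_(S in activations l)
      p_act u S * reduction x u m S.

Definition latency_reduction_set (R : realFieldType) (s : moe_system R)
  (X : {set ground s}) : R := latency_reduction (decision_of_set X).

Definition P1 (R : realFieldType) (s : moe_system R) : max_problem R :=
  MaxProblem (@latency_reduction R s)
    (fun x : decision s => forall n : server s,
       \sum_(m : model s) \sum_(l in layers m) \sum_(i in experts l)
          (x (n, i))%:R * expert_size m <= capacity n).

(* Weight of v in the knapsack constraint of server n: the size b_m of the
   expert if v lies in V_n, and 0 otherwise. *)
Definition weight (R : realFieldType) (s : moe_system R)
    (n : server s) (v : ground s) : R :=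
  if v \in ground_server n then expert_size (model_of (layer_of v.2)) else 0.

(* Main.v *)
(** With one active expert [i], the routing rule (home server, then the best
other server holding [i], then the cloud) picks the fastest available source:
link delays are nonnegative, and the cloud is the slowest by assumption. So the
latency of a non-local request is, up to a constant, a minimum of fixed delays
over the servers caching [i] and the cloud. Such a minimum is antitone in the
cached set and turns unions into binary minima, hence it is supermodular;
reductions are constants minus these minima, and the objective is a nonnegative
combination of reductions. *)

Require Import Defs.
From mathcomp Require Import all_boot all_order all_algebra.
From mathcomp Require Import ring lra.
Import Order.TTheory GRing.Theory Num.Theory.
Local Open Scope ring_scope.

Section SetFunctions.
Variables (R : realFieldType) (V : finType).
Implicit Types (f : {set V} -> R).

Lemma monotone_sum (I : finType) (P : pred I) (f : I -> {set V} -> R) :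
  (forall i, P i -> monotone_nondecreasing (f i)) ->
  monotone_nondecreasing (fun X => \sum_(i | P i) f i X).
Proof. by move=> fP X Y XY; apply: ler_sum => i /fP; apply. Qed.

Lemma monotone_scale (c : R) f :
  0 <= c -> monotone_nondecreasing f -> monotone_nondecreasing (fun X => c * f X).
Proof. by move=> c0 fP X Y XY; rewrite ler_wpM2l ?fP. Qed.

Lemma submodular_sum (I : finType) (P : pred I) (f : I -> {set V} -> R) :
  (forall i, P i -> submodular (f i)) ->
  submodular (fun X => \sum_(i | P i) f i X).
Proof.
by move=> fP X Y; rewrite -!big_split; apply: ler_sum => i /fP; apply.
Qed.

Lemma submodular_scale (c : R) f :
  0 <= c -> submodular f -> submodular (fun X => c * f X).
Proof. by move=> c0 fP X Y; rewrite -!mulrDr ler_wpM2l ?fP. Qed.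

End SetFunctions.

Lemma card_set1_pred (T : finType) (i : T) (P : pred T) :
  #|[set j in [set i] | P j]| = P i.
Proof.
rewrite -sum1_card (eq_bigl (fun j => (j == i) && P j)); last by move=> j; rewrite !inE.
by rewrite big_mkcondr /= big_pred1_eq; case: (P i).
Qed.

Section SingleExpert.
Variables (R : realFieldType) (s : moe_system R).
Implicit Types (x : decision s) (u : user s) (m : model s) (i : expert s).

(** What fetching a single expert from [n] costs beyond the common uplink and downlink; a zero link
    term at the home server lets home and remote servers enter one minimum. *)
Definition edge_delay u m (n : server s) : R :=
  cp_edge m +
  (if n == home u then 0 else T_EE (home u) n m + T_EE n (home u) m).

Definition cloud_delay u m : R :=
  T_EC (home u) m + T_CE (home u) m + cp_cloud m.

(** The routing priorities are absent here, and the cloud is the default value of the minimum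
    because it holds every expert. *)
Definition fetch_delay x u m i : R :=
  \big[Num.min/cloud_delay u m]_(n : server s | x (n, i)) edge_delay u m n.

(** Only the server [a i] can have a nonzero count, and that count is at most 1, so it coincides
    with its own indicator. *)
Lemma T_OE_set1 x u m i (a : assignment s) : admissible x u [set i] a ->
  T_OE x u m [set i] a =
  (served_other x u i)%:R * edge_delay u m (a i).
Proof.
move=> /'forall_implyP/(_ i (set11 i)) adm.
rewrite /T_OE /beta_other.
under eq_bigr => n' _ do rewrite card_set1_pred.
case: (served_other x u i) adm => [/andP[ai _]|_]; last first.
  by rewrite mul0r big1 // => n' _; rewrite !mul0r addr0.
rewrite (bigD1 (a i)) //= eqxx big1 => [|n' /andP[_ /negPf]].
  by rewrite /edge_delay (negPf ai) /=; ring.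
by rewrite eq_sym => ->; rewrite !mul0r addr0.
Qed.

Lemma T_out_of_set1 x u m i (a : assignment s) :
  n_active m = 1%N -> ~~ local u i -> admissible x u [set i] a ->
  T_out_of x u m [set i] a =
  T_UL u m + T_DL u m +
  ((served_home x u i)%:R * edge_delay u m (home u)
   + (served_other x u i)%:R * edge_delay u m (a i)
   + (served_cloud x u i)%:R * cloud_delay u m).
Proof.
move=> K1 /negPf loc adm.
rewrite /T_out_of T_OE_set1 // /beta_home /beta_cloud !card_set1_pred !lt0b.
by rewrite big_set1 loc K1 /edge_delay eqxx /cloud_delay /=; ring.
Qed.

Lemma edge_delay_home_le u m n : edge_delay u m (home u) <= edge_delay u m n.
Proof.
rewrite /edge_delay eqxx lerD2l; case: eqVneq => // nu.
by rewrite addr_ge0 // divr_ge0 ?ltW ?hidden_size_gt0 ?rate_EE_gt0 // eq_sym.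
Qed.

Lemma edge_delay_le_cloud u m n :
  cloud_slower s -> edge_delay u m n <= cloud_delay u m.
Proof.
case=> other home_le; rewrite /edge_delay; case: eqVneq => nu.
  by rewrite addr0 home_le.
by rewrite addrC other // eq_sym.
Qed.

(** The routing order agrees with the order of the delays: the home server is never slower than
    another server, the cloud never faster than any. Between remote servers, the optimality of the
    assignment decides. *)
Lemma T_out_set1 x u m i : cloud_slower s ->
  n_active m = 1%N -> ~~ local u i ->
  T_out x u m [set i] = T_UL u m + T_DL u m + fetch_delay x u m i.
Proof.
move=> slow K1 loc; rewrite /T_out.
have [adm best] := best_assignmentP x u m [set i].
move: (best_assignment x u m [set i]) adm best => a adm best.
rewrite T_out_of_set1 //; congr (_ + _).
rewrite /served_home /served_other /served_cloud loc /=.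
have [xh|xh] := boolP (x (home u, i)) => /=.
  rewrite !mul0r !addr0 mul1r; apply/le_anti/andP; split.
    by apply: le_bigmin => [|n _]; [exact: edge_delay_le_cloud | exact: edge_delay_home_le].
  exact: bigmin_le_cond.
(* If no server holds [i], the minimum ranges over nothing and equals its default, the cloud
   delay. *)
have [xo|xo] := boolP [exists n : server s, (n != home u) && x (n, i)] => /=; last first.
  rewrite !mul0r !add0r mul1r /fetch_delay big_pred0 // => n.
  move/existsPn: xo => xo.
  by case: (eqVneq n (home u)) (xo n) => [->|_] /= /negPf //; rewrite (negPf xh).
have so : served_other x u i by apply/and3P.
move: (adm) => /'forall_implyP/(_ i (set11 i)); rewrite so => /andP[ah ax].
rewrite !mul0r addr0 add0r mul1r; apply/le_anti/andP; split; last exact: bigmin_le_cond.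
apply: le_bigmin => [|n xn]; first exact: edge_delay_le_cloud.
have nh : n != home u by apply: contraNneq xh => <-.
(* The constant assignment to a caching server [n] competes with the optimal [a]; comparing their
   latencies leaves exactly the two edge delays. *)
have adm' : admissible x u [set i] [ffun=> n].
  by apply/'forall_implyP => j /set1P ->; rewrite ffunE nh xn implybT.
have := best _ adm'; rewrite !T_out_of_set1 // so ffunE lerD2l.
by rewrite /served_home /served_cloud loc (negPf xh) xo /= !mul0r !addr0 !add0r !mul1r.
Qed.

(** Uplink and downlink cancel, and with empty caches the fetch delay is that of the cloud. A local
    expert has the same latency under every decision. *)
Lemma reduction_set1 x u m i : cloud_slower s -> n_active m = 1%N ->
  reduction x u m [set i] =
  (~~ local u i)%:R * (cloud_delay u m - fetch_delay x u m i).
Proof.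
move=> slow K1; rewrite /reduction /T_max /T_token !big_set1.
have [_|loc] := boolP (local u i) => /=; first by ring.
rewrite !T_out_set1 // {1}/fetch_delay big_pred0 => [|n]; first by ring.
by rewrite ffunE inE.
Qed.

Lemma fetch_delay_antitone u m i (X Y : {set ground s}) : X \subset Y ->
  fetch_delay (decision_of_set Y) u m i <= fetch_delay (decision_of_set X) u m i.
Proof.
move=> /subsetP XY; apply: le_bigmin => [|n]; first exact: bigmin_le_id.
by rewrite ffunE => /XY nY; apply: bigmin_le_cond; rewrite ffunE.
Qed.

Lemma fetch_delayU u m i (X Y : {set ground s}) :
  fetch_delay (decision_of_set (X :|: Y)) u m i =
  Num.min (fetch_delay (decision_of_set X) u m i)
          (fetch_delay (decision_of_set Y) u m i).
Proof.
apply/le_anti/andP; split.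
  by rewrite le_min !fetch_delay_antitone ?subsetUl ?subsetUr.
apply: le_bigmin => [|n]; first by rewrite ge_min bigmin_le_id.
rewrite ffunE inE ge_min => /orP[] n_in; apply/orP; [left | right];
  by apply: bigmin_le_cond; rewrite ffunE.
Qed.

Lemma monotone_reduction u m i : cloud_slower s -> n_active m = 1%N ->
  monotone_nondecreasing
    (fun X : {set ground s} => reduction (decision_of_set X) u m [set i]).
Proof.
move=> slow K1 X Y XY; rewrite !reduction_set1 // ler_wpM2l ?ler0n //.
by rewrite lerD2l lerN2 fetch_delay_antitone.
Qed.

Lemma submodular_reduction u m i : cloud_slower s -> n_active m = 1%N ->
  submodular
    (fun X : {set ground s} => reduction (decision_of_set X) u m [set i]).
Proof.
move=> slow K1 X Y; rewrite !reduction_set1 // -!mulrDr ler_wpM2l ?ler0n //.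
(* The union attains the smaller of the two delays and the intersection is at least the larger one,
   while minimum plus maximum is the sum. *)
have := fetch_delay_antitone u m i _ _ (subsetIl X Y).
have := fetch_delay_antitone u m i _ _ (subsetIr X Y).
by rewrite fetch_delayU minElt; case: ifP => _; lra.
Qed.

End SingleExpert.

Theorem proposition1 (R : realFieldType) (s : moe_system R)
    (hcloud : cloud_slower s) (hK : forall m : model s, n_active m = 1%N) :
  [/\ monotone_nondecreasing (@latency_reduction_set R s),
      submodular (@latency_reduction_set R s),
      (forall n : server s,
         0 <= capacity n /\ forall v : ground s, 0 <= weight n v)
    & @same_problem R (P1 s)
        (knapsack_max (@latency_reduction_set R s) (@weight R s) (@capacity R s))
        (@set_of_decision R s)].
Proof.
have p_ge0 (l : layer s) u (S : {set expert s}) : S \in activations l -> 0 <= p_act u S.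
  by rewrite inE => /andP[Sl /eqP]; apply: p_act_ge0.
have U_ge0 : 0 <= 1 / #|user s|%:R :> R by rewrite divr_ge0 ?ler0n.
have single (l : layer s) (S : {set expert s}) :
    S \in activations l -> exists i, S = [set i].
  by rewrite inE hK => /andP[_ /cards1P].
split.
- apply: monotone_scale => //; apply: monotone_sum => u _; apply: monotone_sum => m _.
  apply: monotone_scale; first exact: p_model_ge0.
  apply: monotone_sum => l _; apply: monotone_sum => S Sl.
  apply: monotone_scale; first exact: p_ge0 Sl.
  by have [i ->] := single _ _ Sl; apply: monotone_reduction.
- apply: submodular_scale => //; apply: submodular_sum => u _; apply: submodular_sum => m _.
  apply: submodular_scale; first exact: p_model_ge0.
  apply: submodular_sum => l _; apply: submodular_sum => S Sl.
  apply: submodular_scale; first exact: p_ge0 Sl.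
  by have [i ->] := single _ _ Sl; apply: submodular_reduction.
- move=> n; split=> [|v]; first exact: capacity_ge0.
  by rewrite /weight; case: ifP => // _; rewrite ltW ?expert_size_gt0.
have weightE (x : decision s) (n : server s) :
    \sum_(m : model s) \sum_(l in layers m) \sum_(i in experts l)
       (x (n, i))%:R * expert_size m
    = \sum_(v in set_of_decision x) weight n v.
  (* Both sides reduce to one flat sum over experts: the nested sum partitions them by model, then
     by layer. *)
  transitivity (\sum_i (x (n, i))%:R * expert_size (model_of (layer_of i))).
    rewrite (partition_big (fun i => model_of (layer_of i)) xpredT) //=.
    apply: eq_bigr => m _.
    rewrite (partition_big (@layer_of _ s) (mem (layers m)))  => [|i]; last by rewrite !inE.
    apply: eq_bigr => l; rewrite inE => /eqP lm.
    apply: eq_big => [i|i]; last by rewrite inE => /eqP ->; rewrite lm.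
    by rewrite inE andbC; case: eqP => //= ->; rewrite lm eqxx.
  under eq_bigr => i _ do rewrite mulr_natl mulrb.
  rewrite -big_mkcond /weight -big_mkcondr /=.
  (* Only pairs with first component [n] carry weight, and these correspond to experts. *)
  rewrite (reindex_onto (fun i => (n, i)) snd) /= => [|[n' i] /=]; last first.
    by rewrite !inE /= => /andP[_ /eqP ->].
  by apply: eq_bigl => i; rewrite !inE /= !eqxx !andbT.
split=> [|x|x].
- exact: Bijective (@set_of_decisionK R s) (@decision_of_setK R s).
- by rewrite /= /latency_reduction_set set_of_decisionK.
- by split=> feas n; have := feas n; rewrite weightE.
Qed.
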